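(* Let $d\in\{2,3\}$, let $\mathrm C$ be a nonempty closed convex subset of $\mathbb{R}^d$ and let $\xi_{\mathrm C}$ be its support function. Then, for all $x\in\mathrm C^\perp$, one has $\partial\xi_{\mathrm C}(x)=\mathrm C$, and $\xi_{\mathrm C}$ is twice epi-differentiable at $x$ for any $y\in\mathrm C$ with $$\mathrm{d}_e^2\xi_{\mathrm C}(x\mid y)=\iota_{\mathrm N_{\mathrm C}(y)},$$ where $\mathrm N_{\mathrm C}(y):=\{z\in\mathbb{R}^d\mid z\cdot(c-y)\le0,\ \forall c\in\mathrm C\}$ is the normal cone to $\mathrm C$ at $y$ and $\iota_{\mathrm N_{\mathrm C}(y)}$ is the indicator function defined by $\iota_{\mathrm N_{\mathrm C}(y)}(z):=0$ if $z\in\mathrm N_{\mathrm C}(y)$ and $\iota_{\mathrm N_{\mathrm C}(y)}(z):=+\infty$ otherwise.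
   Context: $\mathrm C^\perp:=\{x\in\mathbb{R}^d\mid x\cdot c=0\ \forall c\in\mathrm C\}$. Support function: $\xi_{\mathrm C}(x):=\sup_{y\in\mathrm C}x\cdot y\in\mathbb{R}\cup\{+\infty\}$. Convex subdifferential of a proper function $\phi:\mathbb{R}^d\to\mathbb{R}\cup\{+\infty\}$: $\partial\phi(x):=\{y\mid y\cdot(z-x)\le\phi(z)-\phi(x)\ \forall z\}$. A family $(\phi_t)_{t>0}$ of functions $\mathbb{R}^d\to\mathbb{R}\cup\{\pm\infty\}$ (Mosco) epi-converges as $t\to0^+$ to $\phi$ if for every $x$: there is $(x_t)_{t>0}\to x$ with $\limsup\phi_t(x_t)\le\phi(x)$; and for every $(x_t)_{t>0}\to x$, $\liminf\phi_t(x_t)\ge\phi(x)$ (in $\mathbb{R}^d$ weak and strong convergence coincide). A proper lower semicontinuous convex function $\phi$ is twice epi-differentiable at $x\in\mathrm{dom}(\phi)$ for $y\in\partial\phi(x)$ if the family $\delta_t^2\phi(x\mid y)(z):=\frac{\phi(x+tz)-\phi(x)-t\,y\cdot z}{t^2}$, $t>0$, Mosco epi-converges; the limit is denoted $\mathrm{d}_e^2\phi(x\mid y)$. *)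

(* Defs.v *)
From HB Require Import structures.
From mathcomp Require Import all_boot all_order all_algebra.
From mathcomp Require Import all_classical all_reals all_analysis.

Set Implicit Arguments.
Unset Strict Implicit.
Unset Printing Implicit Defensive.

Import Order.TTheory GRing.Theory Num.Theory.
Import numFieldNormedType.Exports.

Local Open Scope classical_set_scope.
Local Open Scope ring_scope.

Definition dot (R : realType) (d : nat) (x y : 'rV[R]_d) : R :=
  \sum_(i < d) x ord0 i * y ord0 i.

Definition orthogonal_set (R : realType) (d : nat) (C : set 'rV[R]_d) :
    set 'rV[R]_d :=
  [set x | forall c, C c -> dot x c = 0].

Definition support_function (R : realType) (d : nat) (C : set 'rV[R]_d)
    (x : 'rV[R]_d) : \bar R :=
  ereal_sup [set (dot x y)%:E | y in C].

Definition normal_cone (R : realType) (d : nat) (C : set 'rV[R]_d)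
    (y : 'rV[R]_d) : set 'rV[R]_d :=
  [set z | forall c, C c -> dot z (c - y) <= 0].

Definition indicator (R : realType) (d : nat) (A : set 'rV[R]_d)
    (z : 'rV[R]_d) : \bar R :=
  if z \in A then 0%E else +oo%E.

Definition proper_fun (R : realType) (d : nat) (f : 'rV[R]_d -> \bar R) : Prop :=
  (forall x, (-oo < f x)%E) /\ (exists x, (f x < +oo)%E).

(* Meant for functions that never take the value -oo. *)
Definition convex_efun (R : realType) (d : nat) (f : 'rV[R]_d -> \bar R) : Prop :=
  forall (x y : 'rV[R]_d) (t : R), 0 < t -> t < 1 ->
    (f (t *: x + (1 - t) *: y)%R <= t%:E * f x + (1 - t)%R%:E * f y)%E.

(* In \bar R, u - +oo = -oo for every u, so the subdifferential of a proper
   function is empty at the points where the function is +oo. *)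
Definition subdifferential (R : realType) (d : nat) (f : 'rV[R]_d -> \bar R)
    (x : 'rV[R]_d) : set 'rV[R]_d :=
  [set y | forall z, ((dot y (z - x)%R)%:E <= f z - f x)%E].

(* A family indexed by t > 0 is a function on R of which only the values at
   t > 0 matter: every limit is taken along the filter 0^'+. *)
Definition epi_converges (R : realType) (d : nat)
    (F : R -> 'rV[R]_d -> \bar R) (f : 'rV[R]_d -> \bar R) : Prop :=
  forall x : 'rV[R]_d,
    (exists u : R -> 'rV[R]_d, u t @[t --> 0^'+] --> x /\
       (limf_esup (fun t => F t (u t)) 0^'+ <= f x)%E) /\
    (forall u : R -> 'rV[R]_d, u t @[t --> 0^'+] --> x ->
       (f x <= limf_einf (fun t => F t (u t)) 0^'+)%E).

Definition second_quotient (R : realType) (d : nat) (f : 'rV[R]_d -> \bar R)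
    (x y : 'rV[R]_d) (t : R) (z : 'rV[R]_d) : \bar R :=
  ((f (x + t *: z)%R - f x - (t * dot y z)%R%:E) * ((t ^+ 2)^-1)%R%:E)%E.

Definition twice_epi_differentiable (R : realType) (d : nat)
    (f : 'rV[R]_d -> \bar R) (x y : 'rV[R]_d) : Prop :=
  [/\ proper_fun f, lower_semicontinuous f, convex_efun f,
      (f x < +oo)%E & subdifferential f x y] /\
  exists g : 'rV[R]_d -> \bar R, epi_converges (second_quotient f x y) g.

(* The epi-limit (which is unique), or an arbitrary function if there is none. *)
Definition epi_derivative2 (R : realType) (d : nat) (f : 'rV[R]_d -> \bar R)
    (x y : 'rV[R]_d) : 'rV[R]_d -> \bar R :=
  get [set g : 'rV[R]_d -> \bar R | epi_converges (second_quotient f x y) g].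

(* Main.v *)
(* Since x is orthogonal to C, adding x to the argument does not change the
   support function f of C, and f x = 0. Hence y is a subgradient of f at x iff
   y.w <= f w for all w, which means y \in C by separating y from C through its
   nearest point. Likewise the second-order quotient at z is (f z - y.z) / t: it
   vanishes when z is in the normal cone, and otherwise some c in C satisfies
   z.(c - y) > 0 and the lower bound u.(c - y) / t tends to +oo as u --> z. *)
Require Import Defs.
From HB Require Import structures.
From mathcomp Require Import all_boot all_order all_algebra.
From mathcomp Require Import all_classical all_reals all_analysis.
From mathcomp Require Import ring lra.

Import Order.TTheory GRing.Theory Num.Theory.
Import numFieldNormedType.Exports.

Local Open Scope classical_set_scope.
Local Open Scope ring_scope.

Set Implicit Arguments.
Unset Strict Implicit.

(** * The Euclidean inner product *)

Lemma dotC (R : realType) (d : nat) (x y : 'rV[R]_d) : dot x y = dot y x.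
Proof. by apply: eq_bigr => i _; rewrite mulrC. Qed.

Lemma dotDr (R : realType) (d : nat) (x y z : 'rV[R]_d) :
  dot x (y + z) = dot x y + dot x z.
Proof.
by rewrite /dot -big_split; apply: eq_bigr => i _; rewrite mxE mulrDr.
Qed.

Lemma dotZr (R : realType) (d : nat) (a : R) (x y : 'rV[R]_d) :
  dot x (a *: y) = a * dot x y.
Proof.
by rewrite /dot mulr_sumr; apply: eq_bigr => i _; rewrite mxE mulrCA.
Qed.

Lemma dotBr (R : realType) (d : nat) (x y z : 'rV[R]_d) :
  dot x (y - z) = dot x y - dot x z.
Proof. by rewrite dotDr -scaleN1r dotZr mulN1r. Qed.

Lemma dotDl (R : realType) (d : nat) (x y z : 'rV[R]_d) :
  dot (x + y) z = dot x z + dot y z.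
Proof. by rewrite !(dotC _ z) dotDr. Qed.

Lemma dotZl (R : realType) (d : nat) (a : R) (x y : 'rV[R]_d) :
  dot (a *: x) y = a * dot x y.
Proof. by rewrite !(dotC _ y) dotZr. Qed.

Lemma dot_addZ (R : realType) (d : nat) (t : R) (x y : 'rV[R]_d) :
  dot (x + t *: y) (x + t *: y) =
  dot x x + t * (2 * dot x y + t * dot y y).
Proof. by rewrite dotDl !dotDr !dotZl !dotZr (dotC y x); ring. Qed.

Lemma sqr_coord_le_dot (R : realType) (d : nat) (x : 'rV[R]_d) (i : 'I_d) :
  x ord0 i ^+ 2 <= dot x x.
Proof.
rewrite /dot (bigD1 i) //= expr2 lerDl.
by apply: sumr_ge0 => j _; rewrite -expr2 sqr_ge0.
Qed.

Lemma dot_gt0 (R : realType) (d : nat) (x : 'rV[R]_d) : x != 0 -> 0 < dot x x.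
Proof.
move=> x0; have [i xi0] : exists i, x ord0 i != 0.
  apply/existsP; apply: contraNT x0 => /existsPn xz.
  by apply/eqP/rowP => i; rewrite mxE; apply/eqP; rewrite -[_ == _]negbK xz.
by apply: lt_le_trans (sqr_coord_le_dot x i); rewrite exprn_even_gt0.
Qed.

Lemma cvg_dot (R : realType) (d : nat) (T : Type) (F : set_system T)
    {FF : Filter F} (u v : T -> 'rV[R]_d) (x y : 'rV[R]_d) :
  u t @[t --> F] --> x -> v t @[t --> F] --> y ->
  dot (u t) (v t) @[t --> F] --> dot x y.
Proof.
move=> ux vy; apply: (@cvg_big R^o) => [|i _]; first exact: add_continuous.
apply: cvgM.
- exact: (cvg_comp _ (fun M : 'rV[R]_d => M ord0 i) ux
    (@coord_continuous R _ _ _ _ x)).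
- exact: (cvg_comp _ (fun M : 'rV[R]_d => M ord0 i) vy
    (@coord_continuous R _ _ _ _ y)).
Qed.

(** * Projection onto a closed convex set *)

Lemma exists_nearest_point (R : realType) (d : nat) (C : set 'rV[R]_d)
    (p : 'rV[R]_d) :
  C !=set0 -> closed C ->
  exists2 q, C q & forall c, C c -> dot (q - p) (q - p) <= dot (c - p) (c - p).
Proof.
move=> [c0 Cc0] Ccl; pose D v := dot (v - p) (v - p).
have Dcont : continuous D.
  move=> v; have vp : w - p @[w --> v] --> v - p.
    exact: (@cvgB R 'rV[R]_d _ (nbhs v) _ id _ v p cvg_id (cvg_cst p)).
  exact: (cvg_dot vp vp).
pose r := D c0.
have r0 : 0 <= r by apply: sumr_ge0 => i _; rewrite -expr2 sqr_ge0.
(* [C] may be unbounded, so [D] is minimised over a compact piece of it; the points of [C] left out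
   are farther from [p] than [c0]. *)
pose A := C `&` [set v | D v <= r].
have Acl : closed A.
  apply: closedI => //; apply: closed_comp (@closed_le R r) => v _.
  exact: Dcont.
have Aco : compact A.
  (* The half-width [r + 1] avoids a square root: a real whose square is at most [r] has absolute
     value at most [r + 1]. *)
  pose box i := [set` `[p ord0 i - (r + 1), p ord0 i + (r + 1)]].
  have boxco : compact [set v : 'rV[R]_d | forall i, box i (v ord0 i)].
    by apply: rV_compact => i; exact: segment_compact.
  apply: subclosed_compact Acl boxco _ => v [_ /= Dv] i.
  have := le_trans (sqr_coord_le_dot (v - p) i) Dv.
  rewrite !mxE /box /= in_itv /= => h.
  by apply/andP; split; nra.
have Ac0 : A c0 by split=> //=.
have [||q /set_mem [Cq Dq] qmin] := @EVT_min_rV R d D A _ Aco.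
- by exists c0.
- exact: continuous_subspaceT.
exists q => // c Cc; have [cr|/ltW rc] := leP (D c) r.
  by apply: qmin; rewrite inE.
exact: le_trans Dq rc.
Qed.

(* First-order optimality: the inner product is, up to a factor 2, the
   derivative at q of the squared distance to p in the direction of c. *)
Lemma nearest_point_variational (R : realType) (d : nat) (C : set 'rV[R]_d)
    (p q c : 'rV[R]_d) :
  convex_set C -> C q -> C c ->
  (forall c', C c' -> dot (q - p) (q - p) <= dot (c' - p) (c' - p)) ->
  0 <= dot (q - p) (c - q).
Proof.
move=> Ccvx Cq Cc qmin; rewrite leNgt; apply/negP.
set a := dot _ _ => a0; pose b := dot (c - q) (c - q).
have b0 : 0 <= b by apply: sumr_ge0 => i _; rewrite -expr2 sqr_ge0.
(* Moving from [q] towards [c] by a fraction [t] changes the squared distance to [p] by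
   [t * (2 * a + t * b)]. This [t] lies in the unit interval and satisfies [t * b < - a], so the
   change is negative. *)
pose t := - a / (1 + b - a).
have den0 : 0 < 1 + b - a by lra.
have t0 : 0 < t by rewrite divr_gt0 // oppr_gt0.
have t1 : t <= 1 by rewrite ler_pdivrMr //; lra.
have tb : t * b < - a.
  by rewrite /t mulrAC ltr_pdivrMr //; nra.
have Ct : C (t *: c + (1 - t) *: q).
  by apply/set_mem; apply: (Ccvx c q (Itv01 (ltW t0) t1)); rewrite inE.
have := qmin _ Ct.
have -> : t *: c + (1 - t) *: q - p = (q - p) + t *: (c - q).
  by apply/rowP => i; rewrite !mxE; ring.
by rewrite dot_addZ -/a -/b; nra.
Qed.

(** * Support functions and their subgradients *)

Lemma support_function_ge (R : realType) (d : nat) (C : set 'rV[R]_d)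
    (x c : 'rV[R]_d) :
  C c -> ((dot x c)%:E <= support_function C x)%E.
Proof. by move=> Cc; apply: ereal_sup_ubound; exists c. Qed.

Lemma support_function_le (R : realType) (d : nat) (C : set 'rV[R]_d)
    (x : 'rV[R]_d) (a : \bar R) :
  (forall c, C c -> (dot x c)%:E <= a)%E -> (support_function C x <= a)%E.
Proof. by move=> h; apply: ge_ereal_sup => _ [c Cc <-]; exact: h. Qed.

Lemma support_function_gtNy (R : realType) (d : nat) (C : set 'rV[R]_d)
    (x : 'rV[R]_d) :
  C !=set0 -> (-oo < support_function C x)%E.
Proof.
by move=> [c Cc]; apply: lt_le_trans (support_function_ge x Cc); rewrite ltNyr.
Qed.

Lemma support_function_shift (R : realType) (d : nat) (C : set 'rV[R]_d)
    (x z : 'rV[R]_d) :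
  orthogonal_set C x -> support_function C (x + z) = support_function C z.
Proof.
move=> xC; apply/eqP; rewrite eq_le; apply/andP; split.
- apply: support_function_le => c Cc; rewrite dotDl xC // add0r.
  exact: support_function_ge.
- apply: support_function_le => c Cc.
  have -> : dot z c = dot (x + z) c by rewrite dotDl xC // add0r.
  exact: support_function_ge.
Qed.

Lemma support_function_orthogonal (R : realType) (d : nat) (C : set 'rV[R]_d)
    (x : 'rV[R]_d) :
  C !=set0 -> orthogonal_set C x -> support_function C x = 0%E.
Proof.
move=> [c0 Cc0] xC; apply/eqP; rewrite eq_le; apply/andP; split.
- by apply: support_function_le => c Cc; rewrite xC.
- by rewrite -[0%E]/(0%:E) -(xC _ Cc0); exact: support_function_ge.
Qed.

Lemma convex_support_function (R : realType) (d : nat) (C : set 'rV[R]_d) :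
  convex_efun (support_function C).
Proof.
move=> x y t t0 t1; apply: support_function_le => c Cc.
rewrite dotDl !dotZl EFinD !EFinM; apply: leeD; apply: lee_wpmul2l.
- by rewrite lee_fin ltW.
- exact: support_function_ge.
- by rewrite lee_fin subr_ge0 ltW.
- exact: support_function_ge.
Qed.

(** A real below the supremum is already exceeded by a single [c], and exceeding it at that [c] is
    an open condition on the point. *)
Lemma lsc_support_function (R : realType) (d : nat) (C : set 'rV[R]_d) :
  lower_semicontinuous (support_function C).
Proof.
move=> x a /ereal_sup_gt[_ [c Cc <-]]; rewrite lte_fin => ac.
exists [set y | a < dot y c].
  exact: (cvgr_gt (dot x c)
    (@cvg_dot _ _ _ (nbhs x) _ id _ x c cvg_id (cvg_cst c))).
move=> y /= ay; apply: lt_le_trans (support_function_ge y Cc).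
by rewrite lte_fin.
Qed.

Lemma subdifferential_support_function (R : realType) (d : nat)
    (C : set 'rV[R]_d) (x : 'rV[R]_d) :
  C !=set0 -> closed C -> convex_set C -> orthogonal_set C x ->
  subdifferential (support_function C) x = C.
Proof.
move=> C0 Ccl Ccvx xC; apply/seteqP; split=> [p pC|y Cy z]; last first.
  rewrite (support_function_orthogonal C0 xC) sube0 dotBr (dotC y x).
  by rewrite xC // subr0 dotC; exact: support_function_ge.
have [q Cq qmin] := @exists_nearest_point R d C p C0 Ccl.
have [<-//|qp] := eqVneq q p.
have w0 : 0 < dot (p - q) (p - q) by apply: dot_gt0; rewrite subr_eq0 eq_sym.
(* Testing the subgradient inequality in the direction [p - q] bounds [dot p (p - q)] by the support
   function there. The variational inequality bounds the latter by [dot (p - q) q], so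
   [dot (p - q) (p - q) <= 0]. *)
have := pC (x + (p - q)).
rewrite support_function_shift // (support_function_orthogonal C0 xC) sube0.
rewrite addrC addKr => pw.
have : (support_function C (p - q) <= (dot (p - q) q)%:E)%E.
  apply: support_function_le => c Cc; rewrite lee_fin.
  have := nearest_point_variational Ccvx Cq Cc qmin.
  by rewrite -opprB -scaleN1r dotZl dotBr; lra.
move/(le_trans pw); rewrite lee_fin; move: w0; rewrite dotBr (dotC p); lra.
Qed.

(** * Limits inferior and superior, uniqueness of epi-limits *)

Lemma limf_esup_le (R : realType) (T : choiceType) (X : filteredType T)
    (F : set_system X) (f : X -> \bar R) (a : \bar R) :
  (\forall t \near F, f t <= a)%E -> (limf_esup f F <= a)%E.
Proof.
move=> fa; rewrite limf_esupE; apply: ge_ereal_inf.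
exists (ereal_sup [set f t | t in [set t | (f t <= a)%E]]).
  by exists [set t | (f t <= a)%E].
by apply: ge_ereal_sup => _ [t ta <-].
Qed.

Lemma limf_einf_ge (R : realType) (T : choiceType) (X : filteredType T)
    (F : set_system X) (f : X -> \bar R) (a : \bar R) :
  (\forall t \near F, a <= f t)%E -> (a <= limf_einf f F)%E.
Proof.
move=> fa; rewrite limf_einfE; apply: le_ereal_sup_tmp.
exists (ereal_inf [set f t | t in [set t | (a <= f t)%E]]).
  by exists [set t | (a <= f t)%E].
by apply: le_ereal_inf_tmp => _ [t ta <-].
Qed.

Lemma limf_einf_le_esup (R : realType) (T : choiceType) (X : filteredType T)
    (F : set_system X) (f : X -> \bar R) :
  ProperFilter F -> (limf_einf f F <= limf_esup f F)%E.
Proof.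
move=> FF; rewrite limf_einfE limf_esupE.
apply: ge_ereal_sup => _ [A FA <-]; apply: le_ereal_inf_tmp => _ [B FB <-].
have [t [At Bt]] := filter_ex (filterI FA FB).
apply: (@le_trans _ _ (f t)); first by apply: ereal_inf_lbound; exists t.
by apply: ereal_sup_ubound; exists t.
Qed.

(** A recovery family for one limit, inserted in the lower bound for the other, compares the two
    limits pointwise; the roles are then exchanged. *)
Lemma epi_converges_unique (R : realType) (d : nat)
    (F : R -> 'rV[R]_d -> \bar R) (f g : 'rV[R]_d -> \bar R) :
  epi_converges F f -> epi_converges F g -> f = g.
Proof.
suff le h k :
    epi_converges F h -> epi_converges F k -> forall x, (h x <= k x)%E.
  move=> Ff Fg; apply/funext => x.
  by apply/eqP; rewrite eq_le !le.
move=> Fh Fk x; have [[u [ux uk]] _] := Fk x; have [_ hu] := Fh x.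
apply: le_trans (hu _ ux) _; apply: le_trans uk; exact: limf_einf_le_esup.
Qed.

(** * Second-order difference quotients *)

(** Only the term of [c] is kept in the supremum. The choice of [c] is left open: [c = y] gives
    nonnegativity, and a [c] violating the normal cone condition gives divergence. *)
Lemma second_quotient_ge (R : realType) (d : nat) (C : set 'rV[R]_d)
    (x y c z : 'rV[R]_d) (t : R) :
  orthogonal_set C x -> C c -> 0 < t ->
  ((dot z (c - y) / t)%:E
     <= second_quotient (support_function C) x y t z)%E.
Proof.
move=> xC Cc t0; rewrite /second_quotient support_function_shift //.
rewrite (@support_function_orthogonal _ _ C x) //; last by exists c.
have -> : dot z (c - y) / t = (dot (t *: z) c - t * dot y z) * (t ^+ 2)^-1.
  by rewrite dotZl dotBr (dotC y); field; rewrite gt_eqF.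
rewrite sube0 EFinM lee_wpmul2r // ?lee_fin ?invr_ge0 ?sqr_ge0 // EFinB.
by rewrite leeB //; exact: support_function_ge.
Qed.

(** For [z] in the normal cone at [y], the supremum at [t *: z] is attained at [y], so the numerator
    cancels. *)
Lemma second_quotient_normal_cone (R : realType) (d : nat) (C : set 'rV[R]_d)
    (x y z : 'rV[R]_d) (t : R) :
  orthogonal_set C x -> C y -> normal_cone C y z -> 0 < t ->
  second_quotient (support_function C) x y t z = 0%E.
Proof.
move=> xC Cy zN t0; rewrite /second_quotient support_function_shift //.
rewrite (@support_function_orthogonal _ _ C x) //; last by exists y.
have -> : support_function C (t *: z) = (t * dot y z)%:E.
  rewrite dotC -dotZl; apply/eqP; rewrite eq_le support_function_ge // andbT.
  apply: support_function_le => c Cc; rewrite lee_fin !dotZl ler_pM2l //.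
  by have := zN _ Cc; rewrite dotBr subr_le0.
by rewrite sube0 -EFinB subrr mul0e.
Qed.

Lemma epi_converges_second_quotient (R : realType) (d : nat)
    (C : set 'rV[R]_d) (x y : 'rV[R]_d) :
  orthogonal_set C x -> C y ->
  epi_converges (second_quotient (support_function C) x y)
    (indicator (normal_cone C y)).
Proof.
move=> xC Cy z; rewrite /indicator; have [/set_mem zN|zN] := ifPn; split.
- exists (fun=> z); split; first exact: cvg_cst.
  apply: limf_esup_le; near=> t.
  by rewrite second_quotient_normal_cone //; near: t; exact: nbhs_right_gt.
- move=> u _; apply: limf_einf_ge; near=> t.
  have t0 : 0 < t by near: t; exact: nbhs_right_gt.
  apply: le_trans (second_quotient_ge y (u t) xC Cy t0).
  by rewrite subrr -(scale0r y) dotZr mul0r mul0r.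
- by exists (fun=> z); split; [exact: cvg_cst|rewrite leey].
- move=> u uz.
  have [c Cc zc] : exists2 c, C c & 0 < dot z (c - y).
    apply: contrapT => h; move/negP: zN; apply; apply/mem_set => c Cc.
    by rewrite leNgt; apply/negP => zc; apply: h; exists c.
  suff -> : limf_einf
      (fun t => second_quotient (support_function C) x y t (u t)) 0^'+ = +oo%E.
    by [].
  (* Half of the limit value leaves room for [u t] to differ from [z]: eventually
     [dot (u t) (c - y)] exceeds this half, and dividing it by a small enough [t] passes any [A]. *)
  have m0 : dot z (c - y) / 2 < dot z (c - y) by lra.
  apply/eqyP => A A0; apply: limf_einf_ge; near=> t.
  have t0 : 0 < t by near: t; exact: nbhs_right_gt.
  apply: le_trans (second_quotient_ge y (u t) xC Cc t0).
  have ut : dot z (c - y) / 2 < dot (u t) (c - y).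
    by near: t; exact: (cvgr_gt (dot z (c - y)) (cvg_dot uz (cvg_cst (c - y)))).
  have tA : t < dot z (c - y) / 2 / A.
    by near: t; apply: nbhs_right_lt; rewrite !divr_gt0.
  rewrite lee_fin ler_pdivlMr // ltW // (lt_trans _ ut) // mulrC.
  by rewrite -ltr_pdivlMr.
Unshelve. all: by end_near.
Qed.

Unset Implicit Arguments.
Set Strict Implicit.

Theorem proposition2p20 (R : realType) (d : nat) (hd : d = 2%N \/ d = 3%N)
    (C : set 'rV[R]_d) (C_nonempty : C !=set0) (C_closed : closed C)
    (C_convex : convex_set C) :
  forall x : 'rV[R]_d, orthogonal_set C x ->
    subdifferential (support_function C) x = C /\
    (forall y : 'rV[R]_d, C y ->
       twice_epi_differentiable (support_function C) x y /\
       epi_derivative2 (support_function C) x y = indicator (normal_cone C y)).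
Proof.
move=> x xC.
have fx0 := @support_function_orthogonal R d C x C_nonempty xC.
have subC := @subdifferential_support_function R d C x
  C_nonempty C_closed C_convex xC.
split=> // y Cy.
have epi := @epi_converges_second_quotient R d C x y xC Cy.
split; last first.
  (* [get] returns some epi-limit, since one exists; uniqueness identifies it with the indicator. *)
  apply: (epi_converges_unique _ epi).
  apply: (@getPex _ [set g | epi_converges _ g]).
  by exists (indicator (normal_cone C y)).
split; last by exists (indicator (normal_cone C y)).
split.
- split; first by move=> z; exact: support_function_gtNy.
  by exists x; rewrite fx0 ltry.
- exact: lsc_support_function.
- exact: convex_support_function.
- by rewrite fx0 ltry.
- by rewrite subC.
Qed.
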